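(* Let $F(z)=\sum_{k=0}^{n}A_kz^{n-k}\in\mathbb C[z]^{p\times p}$ be monic ($A_0=I_p$) of degree $n$. Let $(\mathbf s_k)_{k\ge0}$ be the sequence of right Markov parameters of $F$ if $n=2m$, or of right Markov parameters of second type of $F$ if $n=2m+1$, and assume that the truncated sequence $\mathscr S=(\mathbf s_k)_{k=0}^{n-1}$ consists of Hermitian matrices. Then $F$ is a Hurwitz matrix polynomial if and only if $\mathscr S$ is Stieltjes positive definite, i.e. both block Hankel matrices $[\mathbf s_{j+k}]_{j,k=0}^{\lfloor (n-1)/2\rfloor}$ and $[\mathbf s_{j+k+1}]_{j,k=0}^{\lfloor (n-2)/2\rfloor}$ are positive definite.
   Context: Even/odd parts: if $n=2m$, $F_e(z)=\sum_{k=0}^mA_{2k}z^{m-k}$, $F_o(z)=\sum_{k=1}^mA_{2k-1}z^{m-k}$; if $n=2m+1$, $F_e(z)=\sum_{k=0}^mA_{2k+1}z^{m-k}$, $F_o(z)=\sum_{k=0}^mA_{2k}z^{m-k}$. For $n=2m$ the right Markov parameters are defined by $F_o(z)F_e(z)^{-1}=\sum_{k\ge0}(-1)^kz^{-(k+1)}\mathbf s_k$ for large $|z|$; for $n=2m+1$ the right Markov parameters of second type are defined by $F_e(z)F_o(z)^{-1}=\sum_{k\ge0}(-1)^kz^{-k}\mathbf s_k$ for large $|z|$. A monic matrix polynomial $F$ is a Hurwitz matrix polynomial (Hurwitz stable) if all roots of $\det F(z)$ lie in the open left half-plane $\operatorname{Re}z<0$. *)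

(* Defs.v *)
From HB Require Import structures.
From mathcomp Require Import all_boot all_order all_algebra.
From mathcomp Require Import complex.
From mathcomp Require Import reals.
Set Implicit Arguments. Unset Strict Implicit. Unset Printing Implicit Defensive.
Import Order.TTheory GRing.Theory Num.Theory.
Local Open Scope ring_scope.
Local Open Scope complex_scope.

Section Defs.
Variables (R : realType) (p : nat).
Local Notation C := R[i].

Definition ctr m n (M : 'M[C]_(m, n)) : 'M[C]_(n, m) := (map_mx Num.conj M)^T.
Definition hermitian_mx n (M : 'M[C]_n) : Prop := ctr M = M.

Definition posdef_mx n (M : 'M[C]_n) : Prop :=
  hermitian_mx M /\ forall v : 'cV[C]_n, v != 0 -> 0 < (ctr v *m M *m v) 0 0.

Definition Fpoly (n : nat) (A : nat -> 'M[C]_p) : 'M[{poly C}]_p :=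
  \matrix_(i, j) \sum_(k < n.+1) (A k i j)%:P * 'X^(n - k).

Definition hurwitz (n : nat) (A : nat -> 'M[C]_p) : Prop :=
  forall z : C, root (\det (Fpoly n A)) z -> 'Re z < 0.

(* Coefficients of the even / odd parts, with m = n./2, indexed by k as in
   F_e(z) = sum_k Fe_coef k z^(m-k),  F_o(z) = sum_k Fo_coef k z^(m-k);
   zero outside the index ranges of the paper.
   n = 2m   : F_e = sum_{k=0}^m A_{2k} z^{m-k},   F_o = sum_{k=1}^m A_{2k-1} z^{m-k}
   n = 2m+1 : F_e = sum_{k=0}^m A_{2k+1} z^{m-k}, F_o = sum_{k=0}^m A_{2k} z^{m-k} *)
Definition Fe_coef (n : nat) (A : nat -> 'M[C]_p) (k : nat) : 'M[C]_p :=
  if ~~ odd n then (if (k <= n./2)%N then A k.*2 else 0)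
  else (if (k <= n./2)%N then A k.*2.+1 else 0).

Definition Fo_coef (n : nat) (A : nat -> 'M[C]_p) (k : nat) : 'M[C]_p :=
  if ~~ odd n then (if (1 <= k <= n./2)%N then A k.*2.-1 else 0)
  else (if (k <= n./2)%N then A k.*2 else 0).

(* Markov parameters, via the Laurent expansion at infinity (coefficientwise).
   n = 2m   : F_o(z) = (sum_k (-1)^k z^{-(k+1)} s_k) F_e(z); comparing coefficients
              of z^{m-1-r} gives  Fo_coef (r+1) = sum_{j+k=r} (-1)^k s_k Fe_coef j.
   n = 2m+1 : F_e(z) = (sum_k (-1)^k z^{-k} s_k) F_o(z); comparing coefficients
              of z^{m-r} gives  Fe_coef r = sum_{j+k=r} (-1)^k s_k Fo_coef j.
   (Right Markov parameters for n even, right Markov parameters of second type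
   for n odd.)  Since A_0 = I these equations determine s uniquely. *)
Definition markov_params (n : nat) (A : nat -> 'M[C]_p) (s : nat -> 'M[C]_p) : Prop :=
  if ~~ odd n then
    forall r : nat, Fo_coef n A r.+1 =
      \sum_(j < r.+1) ((-1) ^+ (r - j) *: (s (r - j)%N *m Fe_coef n A j))
  else
    forall r : nat, Fe_coef n A r =
      \sum_(j < r.+1) ((-1) ^+ (r - j) *: (s (r - j)%N *m Fo_coef n A j)).

Definition hankel (s : nat -> 'M[C]_p) (d q : nat) :
    'M[C]_(\sum_(i < q) p, \sum_(i < q) p) :=
  \mxblock_(j < q, k < q) s (j + k + d)%N.

(* Stieltjes positive definite truncated sequence (s_k)_{k=0}^{n-1}:
   [s_{j+k}]_{j,k=0}^{floor((n-1)/2)} and [s_{j+k+1}]_{j,k=0}^{floor((n-2)/2)}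
   positive definite (sizes (n+1)/2 and n/2 blocks; empty matrix if size 0). *)
Definition stieltjes_posdef (n : nat) (s : nat -> 'M[C]_p) : Prop :=
  posdef_mx (hankel s 0 n.+1./2) /\ posdef_mx (hankel s 1 n./2).

End Defs.

(* Main.v *)
(** Write [a k = A k] for [k <= n] and [0] beyond, and put [g k = 0] for odd
    [k], [g k.*2 = (-1) ^+ k *: s k].  In both parities of [n] the Markov
    equations say that [M P^-1 = \sum_k z^(-k-1) g k], where [P] and [M]
    collect the terms of [F] with even and odd index.  The signed block Hankel
    matrix [Q = [(-1)^i g (i+j)]] splits by the parity of the indices into the
    two Stieltjes Hankel matrices, so it is positive definite iff they are.
    If [T0] is the block companion matrix of [P] and [L] the row of the [g j],
    then [T = T0 - e0 L] linearizes [F], and the linear recurrence of the [g k]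
    turns into the Lyapunov equation [T^* Q + Q T = -2 L^* L].
    When [F] is stable, this makes [Q] positive semidefinite, and an
    eigenvector of [T] in its kernel would give a common zero of [F(z)] and
    [F(-z)].  Conversely, if [Q] is positive definite, an eigenvector [f] with
    eigenvalue [z] has [Re z < 0]: otherwise [L f = 0], which forces [Q f = 0]. *)

Require Import Defs.
From HB Require Import structures.
From mathcomp Require Import all_boot all_order all_algebra.
From mathcomp Require Import complex.
From mathcomp Require Import reals.
From mathcomp Require Import ring zify.
Set Implicit Arguments. Unset Strict Implicit. Unset Printing Implicit Defensive.
Import Order.TTheory GRing.Theory Num.Theory.
Local Open Scope ring_scope.
Local Open Scope sesquilinear_scope.

(** * Semidefinite Hermitian forms and the Lyapunov inequality *)

Section Lyapunov.
Context {C : numClosedFieldType}.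

Lemma trCM m n k (A : 'M[C]_(m, n)) (B : 'M[C]_(n, k)) :
  (A *m B)^t* = B^t* *m A^t*.
Proof. by rewrite trmx_mul map_mxM. Qed.

Lemma trCD m n (A B : 'M[C]_(m, n)) : (A + B)^t* = A^t* + B^t*.
Proof. by rewrite linearD /= map_mxD. Qed.

Lemma trCN m n (A : 'M[C]_(m, n)) : (- A)^t* = - A^t*.
Proof. by rewrite linearN /= map_mxN. Qed.

Lemma trC0 m n : (0 : 'M[C]_(m, n))^t* = 0.
Proof. by rewrite trmx0 map_mx0. Qed.

Lemma trCZ m n (a : C) (A : 'M[C]_(m, n)) : (a *: A)^t* = a^* *: A^t*.
Proof. by rewrite linearZ /= map_mxZ. Qed.

Lemma trC1 n : (1%:M : 'M[C]_n)^t* = 1%:M.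
Proof. by rewrite trmx1 map_mx1. Qed.

Lemma trC_block m1 m2 n1 n2 (A : 'M[C]_(m1, n1)) B D (E : 'M[C]_(m2, n2)) :
  (block_mx A B D E)^t* = block_mx (A^t*) (D^t*) (B^t*) (E^t*).
Proof. by rewrite tr_block_mx map_block_mx. Qed.

Lemma rownorm_sum n (x : 'rV[C]_n) : (x *m x^t*) 0 0 = \sum_i `|x 0 i| ^+ 2.
Proof. by rewrite mxE; apply: eq_bigr => i _; rewrite !mxE normCK. Qed.

Lemma rownorm_ge0 n (x : 'rV[C]_n) : 0 <= (x *m x^t*) 0 0.
Proof. by rewrite rownorm_sum sumr_ge0 // => i _; rewrite exprn_ge0. Qed.

Lemma rownorm_eq0 n (x : 'rV[C]_n) : ((x *m x^t*) 0 0 == 0) = (x == 0).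
Proof.
apply/eqP/eqP => [|->]; last by rewrite mul0mx mxE.
rewrite rownorm_sum => /psumr_eq0P x0; apply/rowP => i; rewrite mxE.
have /eqP := x0 (fun i _ => exprn_ge0 2 (normr_ge0 (x 0 i))) i isT.
by rewrite expf_eq0 /= normr_eq0 => /eqP.
Qed.

Definition qform n (Q : 'M[C]_n) (x : 'rV[C]_n) : C := (x *m Q *m x^t*) 0 0.

Definition psdmx n (Q : 'M[C]_n) : Prop :=
  Q^t* = Q /\ forall x, 0 <= qform Q x.

(** With [z = x *m Q], the form at [x - e *: z] is [e * (e * c - 2 * a)], where [a] is the squared
    norm of [z]; this is negative for small [e > 0] unless [a = 0]. *)
Lemma psdmx_null n (Q : 'M[C]_n) (x : 'rV[C]_n) :
  psdmx Q -> qform Q x = 0 -> x *m Q = 0.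
Proof.
move=> [Qh Qge] Qx; set z := x *m Q; apply/eqP; rewrite -rownorm_eq0.
set a := (z *m z^t*) 0 0; set c := qform Q z.
have a0 : 0 <= a by exact: rownorm_ge0.
have c0 : 0 <= c by exact: Qge.
have key (e : C) : 0 <= e -> 0 <= e * (e * c - 2%:R * a).
  move=> e0; have := Qge (x - e *: z).
  have -> : qform Q (x - e *: z) = e * (e * c - 2 * a); last by [].
  have eE : e^* = e by apply/CrealP; rewrite ger0_real.
  rewrite /qform trCD trCN trCZ eE mulmxBl -scalemxAl -/z.
  rewrite !mulmxBl !mulmxBr -!scalemxAl -!scalemxAr.
  have -> : z *m Q *m x^t* = z *m z^t* by rewrite -mulmxA /z trCM Qh.
  have E : (z *m x^t*) 0 0 = 0 by exact: Qx.
  rewrite /a /c /qform; move: E; move: (_ *m x^t*) (_ *m z^t*) (_ *m z^t*).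
  by move=> u v w E; rewrite !mxE E; ring.
(* Minimizing [key] would give [e = a / c]; [c + 1] avoids the case [c = 0]. *)
rewrite eq_le a0 andbT; apply: contraT => an.
have ap : 0 < a by rewrite lt_neqAle a0 andbT eq_sym; apply: contraNneq an => ->.
have cp : 0 < c + 1 by rewrite ltr_wpDl.
have := key (a / (c + 1)) (ltW (divr_gt0 ap cp)).
rewrite pmulr_rge0 ?divr_gt0 // subr_ge0 => H.
have: 2 * a < 2 * a; last by rewrite ltxx.
apply: (le_lt_trans H); rewrite mulrAC ltr_pdivrMr // mulrDr mulr1.
have -> : 2 * a * c + 2 * a = a * c + (a * c + 2 * a) by ring.
by rewrite ltrDl ltr_wpDl ?mulr_ge0 // mulr_gt0.
Qed.

Lemma psdmx_congr m n (L : 'M[C]_(m, n)) (Q : 'M[C]_n) :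
  psdmx Q -> psdmx (L *m Q *m L^t*).
Proof.
move=> [Qh Qge]; split; first by rewrite !trCM trmxCK Qh mulmxA.
by move=> x; have := Qge (x *m L); rewrite /qform trCM !mulmxA.
Qed.

Definition lyap n (A Q : 'M[C]_n) : 'M[C]_n := - (A *m Q + Q *m A^t*).

Lemma lyap_congr n (L L' A Q : 'M[C]_n) : L' *m L = 1%:M ->
  lyap (L *m A *m L') (L *m Q *m L^t*) = L *m lyap A Q *m L^t*.
Proof.
move=> L'L; rewrite /lyap mulmxN mulNmx mulmxDr mulmxDl !trCM !mulmxA.
rewrite -[L *m A *m L' *m L]mulmxA L'L mulmx1.
by rewrite -[L *m Q *m L^t* *m _]mulmxA -trCM L'L trC1 mulmx1.
Qed.

Lemma psdmx_congrK n (L L' Q : 'M[C]_n) : L' *m L = 1%:M ->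
  psdmx (L *m Q *m L^t*) -> psdmx Q.
Proof.
move=> L'L /(psdmx_congr L'); rewrite !mulmxA L'L mul1mx -mulmxA -trCM.
by rewrite L'L trC1 mulmx1.
Qed.

Lemma psdmx_drblock m n (P : 'M[C]_m) B D (Q : 'M[C]_n) :
  psdmx (block_mx P B D Q) -> psdmx Q.
Proof.
move=> /(psdmx_congr (row_mx 0 1%:M)).
rewrite mul_row_block !mul0mx !add0r !mul1mx tr_row_mx map_col_mx mul_row_col.
by rewrite trC0 trC1 mulmx0 mulmx1 add0r.
Qed.

Lemma psdmx_diag_block m n (P : 'M[C]_m) (Q : 'M[C]_n) :
  psdmx P -> psdmx Q -> psdmx (block_mx P 0 0 Q).
Proof.
move=> [Ph Pge] [Qh Qge]; split; first by rewrite trC_block !trC0 Ph Qh.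
move=> x; rewrite -[x]hsubmxK; set y := lsubmx x; set z := rsubmx x.
suff -> : qform (block_mx P 0 0 Q) (row_mx y z) = qform P y + qform Q z.
  by rewrite addr_ge0.
rewrite /qform mul_row_block !mulmx0 addr0 add0r tr_row_mx map_col_mx.
by rewrite mul_row_col mxE.
Qed.

Lemma Re_lt0_conjD (t : C) : 'Re t < 0 -> t + t^* < 0.
Proof. by rewrite ReE pmulr_llt0 // invr_gt0. Qed.

Lemma trC_scalar n (a : C) : (a%:M : 'M_n)^t* = (a^*)%:M.
Proof. by rewrite tr_scalar_mx map_scalar_mx. Qed.

Lemma lyap_block m n (T : 'M[C]_m) (d : 'M[C]_(n, m)) (A : 'M[C]_n)
    (P : 'M[C]_m) (r : 'M[C]_(m, n)) (Q : 'M[C]_n) :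
  lyap (block_mx T 0 d A) (block_mx P r (r^t*) Q) =
  block_mx (lyap T P) (- (T *m r + (P *m d^t* + r *m A^t*)))
    (- (d *m P + A *m r^t* + r^t* *m T^t*))
    (lyap A Q - (d *m r + r^t* *m d^t*)).
Proof.
rewrite /lyap trC_block !mulmx_block trC0 add_block_mx opp_block_mx.
rewrite !mul0mx !mulmx0 !addr0 -opprD; congr (block_mx _ _ _ (- _)).
by rewrite addrACA addrC.
Qed.

(** Induction on the size by Schur complements: the corner of [lyap A Q] yields [q >= 0], and once
    the first row and column of [Q] are cleared, the remaining block satisfies the hypotheses with
    [A']. *)
Lemma psdmx_lyap_trig n (A Q : 'M[C]_n) : is_trig_mx A ->
  (forall i, 'Re (A i i) < 0) -> Q^t* = Q -> psdmx (lyap A Q) -> psdmx Q.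
Proof.
elim: n A Q => [|n IHn] A Q Atrig Aneg Qh.
  by split=> // x; rewrite /qform [x]thinmx0 !mul0mx mxE.
rewrite -[n.+1]/(1 + n)%N in A Q Atrig Aneg Qh *.
set t := A 0 0; set d := dlsubmx A; set A' := drsubmx A.
have AE : A = block_mx t%:M 0 d A'.
  rewrite -[A]submxK; congr block_mx.
    by apply/matrixP=> i j; rewrite !ord1 !mxE /t; congr (A _ _); apply/val_inj.
  apply/matrixP=> i j; rewrite !mxE; apply/(is_trig_mxP Atrig).
  by rewrite !ord1.
have A'trig : is_trig_mx A'.
  apply/is_trig_mxP => i j ij; rewrite !mxE.
  by apply/(is_trig_mxP Atrig); rewrite /= ltn_add2l.
have A'neg i : 'Re (A' i i) < 0 by rewrite !mxE; exact: Aneg.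
have tneg : t + t^* < 0 by apply/Re_lt0_conjD/Aneg.
set q := Q 0 0; set r := ursubmx Q; set Q' := drsubmx Q.
have QE : Q = block_mx q%:M r (r^t*) Q'.
  rewrite -[Q]submxK; congr block_mx.
    by apply/matrixP=> i j; rewrite !ord1 !mxE /q; congr (Q _ _); apply/val_inj.
  by rewrite -[in LHS]Qh; apply/matrixP=> i j; rewrite !mxE.
have q_real : q^* = q by rewrite /q -{1}Qh !mxE conjCK.
move=> Rpsd; have := Rpsd.
rewrite {1}AE {1}QE lyap_block.
set R11 := lyap _ _; set R12 := - _; set R21 := - _; set R22 := _ - _ => Rp.
have R11E : R11 = (- ((t + t^*) * q))%:M.
  by rewrite /R11 /lyap trC_scalar -!scalar_mxM -!raddfD -raddfN; congr (_%:M); ring.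
have R00 : qform (block_mx R11 R12 R21 R22) (row_mx 1%:M 0) = - ((t + t^*) * q).
  rewrite /qform mul_row_block !mul0mx !addr0 !mul1mx tr_row_mx map_col_mx.
  by rewrite mul_row_col trC1 trC0 mulmx1 mulmx0 addr0 R11E mxE mulr1n.
have q_ge0 : 0 <= q.
  have [_ /(_ (row_mx 1%:M 0))] := Rp.
  by rewrite R00 -mulNr pmulr_rge0 // oppr_gt0.
have [c rE] : exists c, r = q *: c.
  have [q0|qn0] := eqVneq q 0; last first.
    by exists (q^-1 *: r); rewrite scalerA divff // scale1r.
  exists 0; rewrite q0 scale0r.
  have := psdmx_null Rp (x := row_mx 1%:M 0).
  rewrite R00 q0 mulr0 oppr0 => /(_ erefl).
  rewrite mul_row_block !mul0mx !addr0 !mul1mx -row_mx0.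
  move=> /eq_row_mx [_ /eqP]; rewrite oppr_eq0 q0 mul_scalar_mx mul_scalar_mx.
  rewrite scale0r add0r -mul_mx_scalar -mulmxDr => /eqP rM0.
  have Mu : (t^*)%:M + A' \in unitmx.
    rewrite unitmxE unitfE det_trig.
      apply/prodf_neq0 => i _; rewrite mxE [_%:M _ _]mxE eqxx mulr1n.
      apply: contraTneq (A'neg i) => H.
      rewrite -(addKr t^* (A' i i)) H addr0 raddfN /= oppr_lt0 Re_conj.
      by rewrite lt_gtF ?Aneg.
    apply/is_trig_mxP => i j ij; rewrite mxE [_%:M _ _]mxE.
    by rewrite (is_trig_mxP A'trig) // -val_eqE ltn_eqF // addr0.
  have {}rM0 : r *m ((t^*)%:M + A')^t* = 0.
    by rewrite trCD trC_scalar conjCK.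
  have := congr1 (fun M => M *m (invmx ((t^*)%:M + A'))^t*) rM0.
  by rewrite -mulmxA -trCM mulVmx // trC1 mulmx1 mul0mx.
set L : 'M_(1 + n) := block_mx 1%:M 0 (- c^t*) 1%:M.
set L' : 'M_(1 + n) := block_mx 1%:M 0 (c^t*) 1%:M.
have L'L : L' *m L = 1%:M.
  rewrite /L /L' mulmx_block !mul0mx !mulmx0 !mul1mx !mulmx1 !addr0 !add0r.
  by rewrite subrr -scalar_mx_block.
(* The congruence by [L] clears the off-diagonal block of [Q], leaving the
   Schur complement [S]. *)
apply: (psdmx_congrK L'L).
set S := Q' - q *: (c^t* *m c).
have LQ : L *m Q *m L^t* = block_mx q%:M 0 0 S.
  rewrite QE /L trC_block !mulmx_block trC0 !trC1 trCN trmxCK.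
  rewrite !mul0mx !mulmx0 !mul1mx !mulmx1 !addr0 rE trCZ q_real.
  rewrite !mulmxN !mulNmx mul_mx_scalar mul_scalar_mx.
  by rewrite !addNr mul0mx oppr0 add0r -scalemxAr [- _ + Q']addrC.
have LA : L *m A *m L' = block_mx t%:M 0 (- c^t* *m t%:M + d + A' *m c^t*) A'.
  rewrite AE /L /L' !mulmx_block.
  rewrite !mul0mx !mulmx0 !mul1mx !mulmx1 !addr0.
  by rewrite !add0r mul0mx addr0.
have := psdmx_congr L Rpsd.
rewrite -(lyap_congr _ _ L'L) LA LQ.
(* Writing the zero block as [0^t*] matches [lyap_block]; the lower right block is then
   [lyap A' S]. *)
rewrite -[X in block_mx _ _ X S]trC0 lyap_block.
move=> /psdmx_drblock; rewrite trC0 mulmx0 mul0mx addr0 subr0 => Spsd.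
apply: psdmx_diag_block; last first.
  apply: IHn Spsd => //; rewrite /S trCD trCN trCZ trCM trmxCK q_real.
  by congr (_ - _); rewrite /Q' -[in RHS]Qh; apply/matrixP => i j; rewrite !mxE.
split=> [|x]; first by rewrite trC_scalar q_real.
by rewrite /qform mul_mx_scalar -scalemxAl mxE mulr_ge0 ?rownorm_ge0.
Qed.

(** A unitary Schur triangularization reduces to the triangular case. Only semidefiniteness is asked
    of [lyap A Q], since [2 L^* L] has rank at most [p]. *)
Lemma psdmx_lyap n (A Q : 'M[C]_n) : (forall a, eigenvalue A a -> 'Re a < 0) ->
  Q^t* = Q -> psdmx (lyap A Q) -> psdmx Q.
Proof.
case: n A Q => [|n] A Q Aneg Qh Rpsd.
  by split=> // x; rewrite /qform [x]thinmx0 !mul0mx mxE.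
have [P Pu] := Schur A (ltn0Sn n).
rewrite [_ _ _]/(is_trig_mx (conjmx P A)) conjymx // => Ptrig.
have PP : P^t* *m P = 1%:M by rewrite -invmx_unitary // mulVmx // unitarymx_unit.
apply: (psdmx_congrK PP); apply: (psdmx_lyap_trig Ptrig).
- move=> i; apply: Aneg.
  have : eigenvalue (P *m A *m P^t*) ((P *m A *m P^t*) i i).
    rewrite eigenvalue_root_char char_poly_trig // (bigD1 i) //=.
    by rewrite rootM root_XsubC eqxx.
  move=> /eigenvalueP [v vE vn0]; apply/eigenvalueP; exists (v *m P).
    have := congr1 (mulmx^~ P) vE.
    by rewrite -scalemxAl !mulmxA -[_ *m P^t* *m P]mulmxA PP mulmx1.
  by apply: contraNneq vn0 => vP0; rewrite -[v]mulmx1 -(unitarymxP Pu) mulmxA vP0 mul0mx.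
- by rewrite !trCM trmxCK Qh mulmxA.
- by rewrite (lyap_congr _ _ PP); apply: psdmx_congr.
Qed.

End Lyapunov.

(** * Invariant subspaces, block matrices and finite sums *)

Lemma stable_eigenvector (C : numClosedFieldType) m n (W : 'M[C]_(m, n)) (A : 'M[C]_n) :
  stablemx W A -> W != 0 ->
  exists v w, [/\ v != 0, (v <= W)%MS & v *m A = w *: v :> 'rV[C]_n].
Proof.
move=> WA W0; have r0 : (0 < \rank W)%N by rewrite lt0n mxrank_eq0.
have [w /eigenvalueP [u uw u0]] := eigenvalue_closed (restrictmx W A) r0.
exists (u *m row_base W), w; split.
- apply: contra_neq u0 => uW; apply: (row_free_inj (row_base_free W)).
  by rewrite uW mul0mx.
- by rewrite (submx_trans (submxMl _ _)) ?eq_row_base.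
- by rewrite scalemxAl -uw -[RHS]mulmxA mulmxKpV ?stablemx_row_base // mulmxA.
Qed.

Section BlockMatrices.
Context {C : numClosedFieldType} {p : nat}.

Lemma trC_mxblock q (B : 'I_q -> 'I_q -> 'M[C]_p) :
  (\mxblock_(i, j) B i j)^t* = \mxblock_(i, j) (B j i)^t*.
Proof. by rewrite tr_mxblock; apply/matrixP => i j; rewrite !mxE. Qed.

Lemma trC_signZ q r (M : 'M[C]_(q, r)) k : ((-1) ^+ k *: M)^t* = (-1) ^+ k *: M^t*.
Proof. by rewrite trCZ rmorphXn rmorphN1. Qed.

Lemma map_mxcol q r (f : C -> C) (B : 'I_q -> 'M[C]_(p, r)) :
  map_mx f (\mxcol_i B i) = \mxcol_i map_mx f (B i).
Proof. by apply/matrixP => i j; rewrite !mxE. Qed.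

Lemma scale_mxcol m q z (f : 'I_m -> 'M[C]_(p, q)) :
  z *: \mxcol_i f i = \mxcol_i (z *: f i).
Proof. by apply/matrixP => i j; rewrite !mxE. Qed.

Lemma sum_mul_delta m (F : 'I_m -> 'M[C]_p) (k : nat) (kN : (k < m)%N) :
  \sum_(i < m) F i *m (i == k :> nat)%:R%:M = F (Ordinal kN).
Proof.
rewrite (bigD1 (Ordinal kN)) //= eqxx mulmx1 big1 ?addr0 // => i.
by rewrite -val_eqE /= => /negPf ->; rewrite mul_mx_scalar scale0r.
Qed.

Lemma sign_subn (m j : nat) : (j <= m)%N -> ~~ odd j ->
  (-1) ^+ (m - j) = (-1) ^+ m :> C.
Proof. by move=> jm oj; rewrite -signr_odd oddB // (negPf oj) addbF signr_odd. Qed.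

End BlockMatrices.

(** Both sides run over [k + j < q]; this regroups the convolutions of [g_rec] by the index of
    [g]. *)
Lemma sum_antidiag (W : nmodType) (G : nat -> nat -> W) q :
  \sum_(r < q) \sum_(j < r.+1) G (r - j)%N j = \sum_(k < q) \sum_(j < q - k) G k j.
Proof.
elim: q => [|q IHq]; first by rewrite !big_ord0.
rewrite big_ord_recr /= IHq [RHS]big_ord_recr /= subSnn big_ord1.
have -> : \sum_(j < q.+1) G (q - j)%N j = \sum_(k < q) G k (q - k)%N + G q 0.
  rewrite (reindex_inj rev_ord_inj) big_ord_recr /= subnn subn0; congr (_ + _).
  by apply: eq_bigr => k _ /=; rewrite subSS subKn // ltnW.
rewrite addrA; congr (_ + _); rewrite -big_split; apply: eq_bigr => k _ /=.
by rewrite subSn 1?ltnW // big_ord_recr.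
Qed.

Lemma sum_parity (W : nmodType) (F : nat -> W) N :
  \sum_(i < N) F i = \sum_(i < N.+1./2) F i.*2 + \sum_(i < N./2) F i.*2.+1.
Proof.
elim: N => [|N IHN]; first by rewrite !big_ord0 addr0.
rewrite big_ord_recr IHN /=; have NE := odd_double_half N.
rewrite uphalf_half; case: (odd N) NE => /= NE.
  by rewrite add1n [X in _ = _ + X]big_ord_recr /= -addrA -[in F N]NE.
by rewrite add0n [X in _ = X + _]big_ord_recr /= addrAC -[in F N]NE.
Qed.

(** * Linearization of a matrix polynomial and its Lyapunov equation *)

Section Companion.
Context {C : numClosedFieldType} {p : nat}.
Variables (n : nat) (a g : nat -> 'M[C]_p).
Local Notation N := n.+1.
Local Notation V := (\sum_(i < N) p)%N.

(** The parity is that of the index, not of the exponent: [a 0] thus lies in the even part, which is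
    monic for either parity of the degree. *)
Definition evpart k := if odd k then 0 else a k.
Definition oddpart k := if odd k then a k else 0.

Hypothesis a0 : a 0 = 1%:M.
Hypothesis a_gt : forall k, (N < k)%N -> a k = 0.
Hypothesis g_odd : forall k, odd k -> g k = 0.
Hypothesis g_herm : forall k, (k < N.*2)%N -> (g k)^t* = g k.
Hypothesis g_rec : forall r, oddpart r.+1 = \sum_(j < r.+1) g (r - j) *m evpart j.

(* [shank], [comp0], [col0], [rowg] and [comp_mx] are [Q], [T0], [e0], [L] and
   [T] of the header, for the degree [N = n.+1]. *)
Definition hank : 'M[C]_V := \mxblock_(i < N, j < N) g (i + j).
Definition shank : 'M[C]_V := \mxblock_(i < N, j < N) ((-1) ^+ i *: g (i + j)).
Definition comp0 : 'M[C]_V := \mxblock_(i < N, j < N)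
  ((i == j.+1 :> nat)%:R%:M - (j == n :> nat)%:R *: evpart (N - i)).
Definition col0 : 'M[C]_(V, p) := \mxcol_(i < N) (i == 0 :> nat)%:R%:M.
Definition rowg : 'M[C]_(p, V) := \mxrow_(j < N) g j.
Definition comp_mx : 'M[C]_V := comp0 - col0 *m rowg.

(** At [r = N + j] the left side of [g_rec] vanishes because its index exceeds [N], and
    [evpart 0 = 1] lets [g (N + j)] be solved for. *)
Lemma g_tail j : g (N + j) = - \sum_(i < N) g (j + i) *m evpart (N - i).
Proof.
have := g_rec (N + j); rewrite /oddpart a_gt; last lia.
rewrite if_same -addnS big_split_ord /= => /esym.
rewrite big_ord_recl /= subn0 {1}/evpart /= a0 mulmx1 -addrA => /eqP.
rewrite addr_eq0 => /eqP ->; congr (- _).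
rewrite [X in _ + X]big_ord_recl /= addrA [X in _ + X]big1 ?addr0; last first.
  by move=> i _; rewrite /evpart a_gt ?if_same ?mulmx0 // /bump /=; lia.
transitivity (\sum_(i < N) g (N + j - i.+1) *m evpart i.+1).
  rewrite big_ord_recr /=; congr (_ + _); congr (g _ *m evpart _); lia.
rewrite (reindex_inj rev_ord_inj) /=; apply: eq_bigr => i _.
by have lti := ltn_ord i; congr (g _ *m evpart _); lia.
Qed.

(** All columns of [comp0] but the last pick the next entry of [g]; the last one reproduces
    [g_tail]. *)
Lemma hank_comp0 : hank *m comp0 = \mxblock_(i < N, j < N) g (i + j).+1.
Proof.
rewrite mul_mxblock; apply: eq_mxblock => i k.
under eq_bigr do rewrite mulmxBr -scalemxAr.
rewrite sumrB -scaler_sumr.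
have [kn|kn] := eqVneq (k : nat) n.
  rewrite big1 => [|j _]; last first.
    by have := ltn_ord j; rewrite kn => /ltn_eqF ->; rewrite mul_mx_scalar scale0r.
  by rewrite sub0r scale1r -g_tail kn addnC addnS.
have kN : (k.+1 < N)%N by have := ltn_ord k; lia.
by rewrite scale0r subr0 (sum_mul_delta (fun j => g (i + j)) kN) /= addnS.
Qed.
Lemma shank_comp0 :
  shank *m comp0 = \mxblock_(i < N, j < N) ((-1) ^+ i *: g (i + j).+1).
Proof.
have := hank_comp0; rewrite [hank *m _]mul_mxblock => /eq_mxblockP H.
rewrite mul_mxblock; apply: eq_mxblock => i k.
by under eq_bigr do rewrite -scalemxAl; rewrite -scaler_sumr H.
Qed.

(** [g (j + k)] can be nonzero only when [j] and [k] have equal parity. Hence [shank] is Hermitian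
    although its sign depends on the row alone. *)
Lemma signZ_g j k : (-1) ^+ j *: g (j + k) = (-1) ^+ k *: g (j + k).
Proof.
have [/g_odd ->|] := boolP (odd (j + k)); first by rewrite !scaler0.
by rewrite -signr_odd -[(-1) ^+ k]signr_odd oddD negb_add => /eqP ->.
Qed.

Lemma shank_herm : shank^t* = shank.
Proof.
rewrite trC_mxblock; apply: eq_mxblock => i j.
rewrite trC_signZ g_herm; first by rewrite addnC signZ_g.
by have := ltn_ord i; have := ltn_ord j; lia.
Qed.

(** The blocks are [((-1) ^+ i + (-1) ^+ j) *: g (i + j).+1]: the signs cancel when [i + j] is odd,
    and [g] vanishes when it is even. *)
Lemma shank_comp0_skew : comp0^t* *m shank + shank *m comp0 = 0.
Proof.
rewrite -{1}shank_herm -trCM shank_comp0 trC_mxblock -mxblockD.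
rewrite -[RHS]mxblock0; apply: eq_mxblock => i j.
rewrite trC_signZ; have [lti ltj] := (ltn_ord i, ltn_ord j).
have [/g_odd E|odd_ij] := boolP (odd (i + j).+1).
  by rewrite [(j + i)%N]addnC E trC0 !scaler0 addr0.
rewrite g_herm; last by move: odd_ij => /=; lia.
rewrite [(j + i)%N]addnC -scalerDl -signr_odd -[(-1) ^+ i]signr_odd.
by move: odd_ij; rewrite /= oddD negbK; case: (odd i); case: (odd j) => //= _;
   rewrite ?addNr ?subrr ?scale0r.
Qed.

Lemma shank_col0 : shank *m col0 = rowg^t*.
Proof.
rewrite mul_mxblock_mxrow; under eq_mxcol => i do
  rewrite (sum_mul_delta (fun j => (-1) ^+ i *: g (i + j)) (ltn0Sn n)) /=
    signZ_g expr0 scale1r addn0.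
rewrite tr_mxrow map_mxcol; apply: eq_mxcol => i; rewrite g_herm //.
by have := ltn_ord i; lia.
Qed.

(** [comp0] drops out by skewness, and the correction [col0 *m rowg] contributes [rowg^t* *m rowg]
    twice through [shank_col0]. *)
Lemma lyap_comp : lyap (comp_mx^t*) shank = rowg^t* *m rowg *+ 2.
Proof.
rewrite /lyap trmxCK /comp_mx trCD trCN trCM mulmxBl mulmxBr addrACA shank_comp0_skew.
rewrite add0r -opprD opprK mulmxA shank_col0 -mulmxA -[in col0^t* *m _]shank_herm.
by rewrite -trCM shank_col0 trmxCK mulr2n.
Qed.
Definition evmx (z : C) (k : nat) : 'M[C]_p :=
  \sum_(j < k.+1) z ^+ (k - j) *: evpart j.

Definition oddmx (z : C) : 'M[C]_p :=
  \sum_(r < N) z ^+ (n - r) *: oddpart r.+1.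

Definition polmx (z : C) : 'M[C]_p := \sum_(k < N.+1) z ^+ (N - k) *: a k.

Lemma evmx0 z : evmx z 0 = 1%:M.
Proof. by rewrite /evmx big_ord1 expr0 scale1r /evpart a0. Qed.

Lemma evmxS z k : evmx z k.+1 = z *: evmx z k + evpart k.+1.
Proof.
rewrite /evmx big_ord_recr /= subnn expr0 scale1r; congr (_ + _).
rewrite scaler_sumr; apply: eq_bigr => j _.
by rewrite scalerA -exprS subSn // -ltnS.
Qed.

Lemma polmxE z : polmx z = evmx z N + oddmx z.
Proof.
have -> : oddmx z = \sum_(k < N.+1) z ^+ (N - k) *: oddpart k.
  by rewrite [RHS]big_ord_recl {1}/oddpart /= scaler0 add0r.
rewrite -big_split /=; apply: eq_bigr => k _; rewrite -scalerDr.
by rewrite /evpart /oddpart; case: ifP; rewrite (add0r, addr0).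
Qed.

(** On indices [k] of one parity the sign [(-1) ^+ (N - k)] is constant, so only the relative sign
    of the two parts changes. *)
Lemma polmxN z : polmx (- z) = (-1) ^+ N *: (evmx z N - oddmx z).
Proof.
rewrite polmxE scalerBr -scalerN; congr (_ + _).
  rewrite /evmx scaler_sumr; apply: eq_bigr => j _; rewrite scalerA (exprNn z).
  rewrite /evpart; case: ifPn => oj; first by rewrite !scaler0.
  by rewrite sign_subn // -ltnS.
rewrite /oddmx -sumrN scaler_sumr; apply: eq_bigr => r _; rewrite scalerN scalerA (exprNn z).
rewrite /oddpart; case: ifPn => oj; last by rewrite !scaler0 oppr0.
rewrite sign_subn // -1?ltnS // -scaleNr exprS; congr (_ *: _); ring.
Qed.

(** The shape of an eigenvector of [comp_mx]: the last block is [l], and each block above it is one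
    Horner step further. *)
Definition krylov q (z : C) (l : 'M[C]_(p, q)) : 'M[C]_(V, q) :=
  \mxcol_(i < N) (evmx z (n - i) *m l).

Lemma comp0_mxcol q (f : nat -> 'M[C]_(p, q)) :
  comp0 *m \mxcol_(i < N) f i =
  \mxcol_(i < N) ((if i == 0 :> nat then 0 else f i.-1) - evpart (N - i) *m f n).
Proof.
rewrite mul_mxblock_mxrow; apply: eq_mxcol => i.
under eq_bigr do rewrite mulmxBl.
rewrite sumrB; congr (_ - _); last first.
  rewrite (bigD1 ord_max) //= eqxx scale1r big1 ?addr0 // => j.
  by rewrite -val_eqE /= => /negPf ->; rewrite scale0r mul0mx.
have lti := ltn_ord i; have [i0|i0] := eqVneq (i : nat) 0.
  by rewrite big1 // => j _; rewrite i0 mul_scalar_mx scale0r.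
have i1 : (i.-1 < N)%N by lia.
rewrite (bigD1 (Ordinal i1)) //= prednK ?lt0n // eqxx mul1mx big1 ?addr0 // => j.
rewrite -val_eqE /= => ji; rewrite (_ : (_ == _) = false) ?mul_scalar_mx ?scale0r //.
by apply/eqP => E; move/eqP: ji; apply; lia.
Qed.

Lemma col0_mul q (l : 'M[C]_(p, q)) :
  col0 *m l = \mxcol_(i < N) (if i == 0 :> nat then l else 0).
Proof.
rewrite mxcol_mul; apply: eq_mxcol => i; case: eqP => _.
  by rewrite mul1mx.
by rewrite mul_scalar_mx scale0r.
Qed.

Lemma comp0_krylov q z (l : 'M[C]_(p, q)) :
  comp0 *m krylov z l = z *: krylov z l - col0 *m (evmx z N *m l).
Proof.
rewrite /krylov (comp0_mxcol (fun i => evmx z (n - i) *m l)) col0_mul scale_mxcol -mxcolB.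
apply: eq_mxcol => i; rewrite subnn evmx0 mul1mx; case: eqP => [->|/eqP i0].
  by rewrite !subn0 evmxS mulmxDl -scalemxAl opprD addrA subrr.
rewrite subr0; have -> : (n - i.-1 = (n - i).+1)%N by have := ltn_ord i; lia.
rewrite evmxS mulmxDl -scalemxAl subSn ?addrK //.
by rewrite -ltnS.
Qed.

(** This is [M = (\sum_k z^(-k-1) g k) P] in polynomial form: the equations [g_rec], weighted by
    powers of [z] and summed. *)
Lemma rowg_krylov q z (l : 'M[C]_(p, q)) : rowg *m krylov z l = oddmx z *m l.
Proof.
rewrite mul_mxrow_mxcol; under eq_bigr do rewrite mulmxA.
rewrite -mulmx_suml; congr (_ *m _); apply: esym.
pose G k j := z ^+ (n - k - j) *: (g k *m evpart j).
transitivity (\sum_(r < N) \sum_(j < r.+1) G (r - j)%N j).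
  apply: eq_bigr => r _; rewrite g_rec scaler_sumr; apply: eq_bigr => j _.
  by congr (z ^+ _ *: _); have := ltn_ord r; have := ltn_ord j; lia.
rewrite (sum_antidiag G); apply: eq_bigr => k _; rewrite mulmx_sumr subSn -1?ltnS //.
by apply: eq_bigr => j _; rewrite -scalemxAr.
Qed.

(** The even part of [polmx z] comes from [comp0], the odd part from the correction. *)
Lemma comp_krylov q z (l : 'M[C]_(p, q)) :
  comp_mx *m krylov z l = z *: krylov z l - col0 *m (polmx z *m l).
Proof.
rewrite /comp_mx mulmxBl comp0_krylov -mulmxA rowg_krylov polmxE mulmxDl mulmxDr.
by rewrite opprD addrA.
Qed.

(** The block rows, read from the last one upwards, force the Horner recursion; the top row is left
    over and gives the kernel equation. *)
Lemma comp_eigen q z (x : 'M[C]_(V, q)) : comp_mx *m x = z *: x ->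
  x = krylov z (submxcol x ord_max) /\ polmx z *m submxcol x ord_max = 0.
Proof.
move=> xz; set l : 'M[C]_(p, q) := submxcol x ord_max.
pose f k : 'M[C]_(p, q) := submxcol x (inord k).
have xE : x = \mxcol_(i < N) f i.
  by rewrite -[LHS]submxcolK; apply: eq_mxcol => i; rewrite /f inord_val.
have fn : f n = l by congr submxcol; apply/val_inj; rewrite /= inordK.
have fE k : (k <= n)%N -> f (n - k)%N = evmx z k *m l.
  elim: k => [|k IHk] kn; first by rewrite subn0 evmx0 mul1mx.
  have iN : ((n - k)%N < N)%N by lia.
  move: xz; rewrite {1 2}xE /comp_mx mulmxBl -mulmxA col0_mul comp0_mxcol scale_mxcol -mxcolB.
  move=> /eq_mxcolP /(_ (Ordinal iN)) /=.
  rewrite subn_eq0 leqNgt kn /= subr0 IHk ?(ltnW kn) //.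
  have -> : (N - (n - k) = k.+1)%N by lia.
  have -> : ((n - k).-1 = n - k.+1)%N by lia.
  move=> /eqP; rewrite subr_eq fn => /eqP ->.
  by rewrite evmxS mulmxDl -scalemxAl.
have xK : x = krylov z l.
  rewrite xE; apply: eq_mxcol => i; rewrite -fE ?leq_subr // subKn //.
  by rewrite -ltnS.
split=> //; move: xz; rewrite xK comp_krylov => /eqP.
rewrite -subr_eq0 addrAC subrr add0r oppr_eq0 col0_mul => /eqP.
by rewrite -mxcol0 => /eq_mxcolP /(_ ord0).
Qed.
(** Once [rowg *m x = 0], also [comp0 *m x = z *: x], so by the shift each block of [hank *m x] is
    [z] times the previous one; the first block is [rowg *m x]. *)
Lemma shank_ker_eigen q z (x : 'M[C]_(V, q)) :
  comp_mx *m x = z *: x -> rowg *m x = 0 -> shank *m x = 0.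
Proof.
rewrite /comp_mx mulmxBl -mulmxA => xz gx; move: xz; rewrite gx mulmx0 subr0 => xz.
pose G i := \sum_(j < N) g (i + j) *m submxcol x j.
have G0 : G 0 = 0 by rewrite -gx -[x in RHS]submxcolK mul_mxrow_mxcol.
have GS i : (i < N)%N -> G i.+1 = z *: G i.
  move=> iN; have := congr1 (mulmx hank) xz; rewrite mulmxA hank_comp0 -scalemxAr.
  rewrite -[x]submxcolK !mul_mxblock_mxrow scale_mxcol => /eq_mxcolP.
  move=> /(_ (Ordinal iN)) /= H; rewrite -[RHS]H.
  by apply: eq_bigr => j _; rewrite addSn.
have {}G0 i : (i <= N)%N -> G i = 0.
  by elim: i => // i IHi iN; rewrite GS // IHi ?scaler0 // ltnW.
rewrite -[x]submxcolK mul_mxblock_mxrow -[RHS]mxcol0; apply: eq_mxcol => i.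
under eq_bigr do rewrite -scalemxAl.
by rewrite -scaler_sumr -/(G i) G0 ?scaler0 // ltnW.
Qed.

Lemma lyap_comp_qform (x : 'rV[C]_V) :
  qform (lyap (comp_mx^t*) shank) x = ((x *m rowg^t*) *m (x *m rowg^t*)^t*) 0 0 *+ 2.
Proof.
rewrite lyap_comp /qform trCM trmxCK -scaler_nat -scalemxAr -scalemxAl mxE mulr_natl.
by rewrite !mulmxA.
Qed.

Lemma eigen_trC (A : 'M[C]_V) (x : 'rV[C]_V) w :
  x *m A^t* = w *: x -> A *m x^t* = w^* *: x^t*.
Proof. by move=> /(congr1 (fun M => M^t*)); rewrite trCM trmxCK trCZ. Qed.

Definition stable := forall z (l : 'cV[C]_p), l != 0 -> polmx z *m l = 0 -> 'Re z < 0.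

Lemma posdef_stable : (forall x, x != 0 -> 0 < qform shank x) -> stable.
Proof.
move=> Qpos z l l0 zl; set y := krylov z l.
have yz : comp_mx *m y = z *: y by rewrite comp_krylov zl mulmx0 subr0.
have y0 : y != 0.
  apply: contra_neq l0 => /(congr1 (fun M => submxcol M ord_max)).
  by rewrite mxcolK submxcol0 subnn evmx0 mul1mx.
have Q0 : 0 < qform shank (y^t*).
  by apply: Qpos; apply: contra_neq y0 => /(congr1 (fun M => M^t*)); rewrite trmxCK trC0.
have yzt : y^t* *m comp_mx^t* = z^* *: y^t* by rewrite -trCM yz trCZ.
(* The Lyapunov equation on the eigenvector [y]: [2 'Re z] times the form is minus twice the squared
   norm of [rowg *m y]. *)
have E : (z + z^*) * qform shank (y^t*) =
    - (((y^t* *m rowg^t*) *m (y^t* *m rowg^t*)^t*) 0 0 *+ 2).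
  rewrite -lyap_comp_qform /qform /lyap mulmxN mulNmx mulmxDr mulmxDl !trmxCK.
  rewrite [y^t* *m (_ *m shank)]mulmxA yzt -!mulmxA yz -!scalemxAl -!scalemxAr !mxE.
  by rewrite opprK mulrDl addrC.
suff : z + z^* < 0 by rewrite ReE; set w := _ / _ => ?; rewrite /w pmulr_llt0 ?invr_gt0.
rewrite -(pmulr_llt0 _ Q0) E oppr_lt0 pmulrn_lgt0 // lt_def rownorm_ge0 andbT rownorm_eq0.
(* Equality would mean [rowg *m y = 0], hence [shank *m y = 0], against [Q0]. *)
apply/eqP => /(congr1 (fun M => M^t*)); rewrite trC0 -trCM trmxCK => /(shank_ker_eigen yz) Qy.
by move: Q0; rewrite /qform trmxCK -mulmxA Qy mulmx0 mxE ltxx.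
Qed.
Lemma stable_posdef : stable -> forall x, x != 0 -> 0 < qform shank x.
Proof.
move=> st.
(* Eigenrows of [comp_mx^t*] for [w] are adjoints of eigencolumns of [comp_mx] for [w^*]; [l] is
   nonzero because [krylov] is linear in [l]. *)
have ev (x : 'rV[C]_V) w : x *m comp_mx^t* = w *: x -> x != 0 ->
    let l : 'cV[C]_p := submxcol (x^t*) ord_max in
    [/\ l != 0, x^t* = krylov (w^*) l & polmx (w^*) *m l = 0].
  move=> /eigen_trC /comp_eigen [xK Fl] x0; split=> //.
  apply: contra_neq x0 => l0; rewrite -[x]trmxCK xK l0.
  by rewrite /krylov; under eq_mxcol do rewrite mulmx0; rewrite mxcol0 trC0.
have Qpsd : psdmx shank.
  apply: (@psdmx_lyap _ _ (comp_mx^t*)); last 2 first.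
  - exact: shank_herm.
  - split; last by move=> x; rewrite lyap_comp_qform mulrn_wge0 ?rownorm_ge0.
    by rewrite lyap_comp -scaler_nat trCZ trCM trmxCK conjC_nat.
  move=> w /eigenvalueP [x xw x0]; rewrite -Re_conj.
  by have [l0 _ /st] := ev x w xw x0; apply.
(* On the kernel of [shank] the Lyapunov equation forces [x *m rowg^t* = 0], and then that kernel is
   stable under [comp_mx^t*]. *)
have null (x : 'rV[C]_V) : x *m shank = 0 ->
    x *m rowg^t* = 0 /\ x *m comp_mx^t* *m shank = 0.
  move=> xQ; have Qx : shank *m x^t* = 0 by rewrite -shank_herm -trCM xQ trC0.
  have xg : x *m rowg^t* = 0.
    apply/eqP; rewrite -rownorm_eq0 -[_ == 0](mulrn_eq0 _ 2) -lyap_comp_qform.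
    rewrite /qform /lyap trmxCK mulmxN mulNmx mulmxDr mulmxDl -!mulmxA Qx.
    by rewrite [x *m (shank *m _)]mulmxA xQ !(mulmx0, mul0mx) addr0 oppr0 mxE.
  split=> //; have := congr1 (mulmx x) lyap_comp.
  rewrite /lyap trmxCK mulmxN mulmxDr [x *m (shank *m _)]mulmxA xQ mul0mx addr0.
  rewrite -scaler_nat -scalemxAr [X in _ *: X]mulmxA xg mul0mx scaler0 => /eqP.
  by rewrite oppr_eq0 mulmxA => /eqP.
move=> x x0; rewrite lt_def (Qpsd.2 x) andbT.
apply: contra_neq x0 => /(psdmx_null Qpsd) xQ.
(* From here on [x != 0] is refuted: the kernel would be a nonzero invariant subspace and contain an
   eigenvector [v]. *)
apply: contraTeq isT => x0 /=.
have W0 : kermx shank != 0.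
  by apply: contraNneq x0 => W0; rewrite -submx0 -W0; apply/sub_kermxP.
have Ws : stablemx (kermx shank) (comp_mx^t*).
  apply/row_subP => i; rewrite row_mul; apply/sub_kermxP.
  by have /null [] : row i (kermx shank) *m shank = 0 by rewrite -row_mul mulmx_ker row0.
have [v [w [v0 /sub_kermxP vQ vw]]] := stable_eigenvector Ws W0.
have [l0 vK Fl] := ev v w vw v0; have [vg _] := null v vQ.
move: l0 vK Fl; set l : 'cV[C]_p := submxcol _ _ => l0 vK Fl.
have Ml : oddmx (w^*) *m l = 0 by rewrite -rowg_krylov -vK -trC0 -vg trCM trmxCK.
have Pl : evmx (w^*) N *m l = 0 by move: Fl; rewrite polmxE mulmxDl Ml addr0.
(* Both parts annihilate [l], so [l] is in the kernel of [polmx] at [w^*] and at [- w^*], whose real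
   parts cannot both be negative. *)
have := st _ l l0 Fl; have := st (- w^*) l l0.
rewrite polmxN -scalemxAl mulmxBl Ml Pl subr0 scaler0 => /(_ erefl).
by rewrite raddfN /= oppr_lt0 => H /(lt_trans H); rewrite ltxx.
Qed.

End Companion.

(** * Block forms, parity splitting and sign changes *)

Section BlockForms.
Context {C : numClosedFieldType} {p : nat}.
Implicit Types (B : nat -> nat -> 'M[C]_p) (f : nat -> 'cV[C]_p).

Definition bform N B f : C :=
  \sum_(i < N) \sum_(j < N) ((f i)^t* *m B i j *m f j) 0 0.

Lemma qform_mxblock N B f :
  qform (\mxblock_(i < N, j < N) B i j) ((\mxcol_(i < N) f i)^t*) = bform N B f.
Proof.
rewrite /qform trmxCK tr_mxcol -mulmxA mul_mxblock_mxrow.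
have -> : map_mx Num.conj (\mxrow_(i < N) (f i)^T) = \mxrow_(i < N) (f i)^t*.
  by apply/matrixP => i j; rewrite !mxE.
rewrite mul_mxrow_mxcol summxE; apply: eq_bigr => i _.
by rewrite mulmx_sumr summxE; apply: eq_bigr => j _; rewrite mulmxA.
Qed.

Lemma qform_mxblock_gt0 N B :
  (forall x, x != 0 -> 0 < qform (\mxblock_(i < N, j < N) B i j) x) <->
  (forall f, (exists2 i, (i < N)%N & f i != 0) -> 0 < bform N B f).
Proof.
split=> pos => [f [i iN fi0]|x x0].
  rewrite -qform_mxblock; apply: pos; apply: contra_neq fi0 => f0.
  have {}f0 : \mxcol_(i < N) f i = 0 by rewrite -[LHS]trmxCK f0 trC0.
  by have := congr1 (fun M => submxcol M (Ordinal iN)) f0; rewrite mxcolK submxcol0.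
case: N B pos x x0 => [|N] B pos x x0.
  case/eqP: x0; apply/rowP => i; have := ltn_ord i; rewrite [X in (_ < X)%N]big_ord0.
  by [].
pose f k : 'cV[C]_p := submxcol (x^t*) (inord k : 'I_N.+1).
have xE : x = (\mxcol_(i < N.+1) f i)^t*.
  rewrite -[LHS]trmxCK -[x^t*]submxcolK; congr (_^t*).
  by apply: eq_mxcol => i; rewrite /f inord_val.
rewrite xE qform_mxblock; apply: pos.
have [/existsP[i fi]|/existsPn f0] := boolP [exists i : 'I_N.+1, f i != 0].
  by exists i.
case/eqP: x0; rewrite xE -[RHS]trC0 -mxcol0; congr (_^t*); apply: eq_mxcol => i.
by apply/eqP; have := f0 i; rewrite negbK.
Qed.

Lemma bform_parity N B f : (forall i j, odd (i + j) -> B i j = 0) ->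
  bform N B f = bform N.+1./2 (fun i j => B i.*2 j.*2) (fun i => f i.*2) +
    bform N./2 (fun i j => B i.*2.+1 j.*2.+1) (fun i => f i.*2.+1).
Proof.
move=> Bodd; rewrite /bform.
rewrite (sum_parity (fun i => \sum_(j < N) ((f i)^t* *m B i j *m f j) 0 0)).
congr (_ + _); apply: eq_bigr => i _.
  rewrite (sum_parity (fun j => ((f i.*2)^t* *m B i.*2 j *m f j) 0 0)).
  rewrite [X in _ + X]big1 ?addr0 // => j _.
  by rewrite Bodd ?mulmx0 ?mul0mx ?mxE // addnS /= oddD !odd_double.
rewrite (sum_parity (fun j => ((f i.*2.+1)^t* *m B i.*2.+1 j *m f j) 0 0)).
rewrite [X in X + _]big1 ?add0r // => j _.
by rewrite Bodd ?mulmx0 ?mul0mx ?mxE // addSn /= oddD !odd_double.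
Qed.

Lemma bform_eq0 N B f : (forall i, (i < N)%N -> f i = 0) -> bform N B f = 0.
Proof.
move=> f0; apply: big1 => i _; apply: big1 => j _.
by rewrite (f0 j) // mulmx0 mxE.
Qed.

(** Families supported on one parity test each summand. Conversely both summands are nonnegative,
    and the one that sees a nonzero vector is positive. *)
Lemma bform_gt0_parity N B : (forall i j, odd (i + j) -> B i j = 0) ->
  (forall f, (exists2 i, (i < N)%N & f i != 0) -> 0 < bform N B f) <->
  (forall f, (exists2 i, (i < N.+1./2)%N & f i != 0) ->
    0 < bform N.+1./2 (fun i j => B i.*2 j.*2) f) /\
  (forall f, (exists2 i, (i < N./2)%N & f i != 0) ->
    0 < bform N./2 (fun i j => B i.*2.+1 j.*2.+1) f).
Proof.
move=> Bodd; split=> [pos|[pos0 pos1] f [k kN fk]].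
  split=> f [i iN fi].
    pose h k := if odd k then 0 else f k./2.
    have := pos h; rewrite bform_parity // [X in _ + X]bform_eq0 => [|j _]; last first.
      by rewrite /h /= odd_double.
    rewrite addr0.
    have -> : bform N.+1./2 (fun i j => B i.*2 j.*2) (fun i => h i.*2) =
              bform N.+1./2 (fun i j => B i.*2 j.*2) f.
      by apply: eq_bigr => j _; apply: eq_bigr => k _; rewrite /h !odd_double !doubleK.
    by apply; exists i.*2; [lia | rewrite /h odd_double doubleK].
  pose h k := if odd k then f k./2 else 0.
  have := pos h; rewrite bform_parity // [X in X + _]bform_eq0 => [|j _]; last first.
    by rewrite /h /= odd_double.
  rewrite add0r.
  have -> : bform N./2 (fun i j => B i.*2.+1 j.*2.+1) (fun i => h i.*2.+1) =
            bform N./2 (fun i j => B i.*2.+1 j.*2.+1) f.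
    by apply: eq_bigr => j _; apply: eq_bigr => k _; rewrite /h /= !odd_double /= !uphalf_double.
  by apply; exists i.*2.+1; [lia | rewrite /h /= odd_double /= uphalf_double].
rewrite bform_parity //.
have ge0 M B' h : (forall f, (exists2 i, (i < M)%N & f i != 0) -> 0 < bform M B' f) ->
    0 <= bform M B' h.
  move=> pos; have [/existsP[i hi]|/existsPn h0] := boolP [exists i : 'I_M, h i != 0].
    by apply/ltW/pos; exists i.
  rewrite bform_eq0 // => i iM; apply/eqP; have := h0 (Ordinal iM).
  by rewrite negbK.
have kE := odd_double_half k; case: (odd k) kE => /= kE.
  rewrite ltr_wpDl ?ge0 //; apply: pos1; exists k./2; [lia | by move: fk; rewrite -{1}kE].
rewrite ltr_wpDr ?ge0 //; apply: pos0; exists k./2; [lia | by move: fk; rewrite -{1}kE].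
Qed.

(** Congruence by the diagonal signs [(-1) ^+ i], an involution. *)
Lemma bform_sign_gt0 N B B' :
  (forall i j, B' i j = (-1) ^+ (i + j) *: B i j) ->
  (forall f, (exists2 i, (i < N)%N & f i != 0) -> 0 < bform N B' f) <->
  (forall f, (exists2 i, (i < N)%N & f i != 0) -> 0 < bform N B f).
Proof.
move=> B'E; have E f : bform N B' f = bform N B (fun i => (-1) ^+ i *: f i).
  apply: eq_bigr => i _; apply: eq_bigr => j _; rewrite B'E trC_signZ exprD.
  by rewrite -!scalemxAl -!scalemxAr -!scalemxAl scalerA.
have EK f : bform N B f = bform N B (fun i => (-1) ^+ i *: ((-1) ^+ i *: f i)).
  apply: eq_bigr => i _; apply: eq_bigr => j _.
  by rewrite !scalerA -!expr2 !sqrr_sign !scale1r.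
have nz f : (exists2 i, (i < N)%N & f i != 0) ->
    exists2 i, (i < N)%N & (-1) ^+ i *: f i != 0.
  by case=> i iN fi; exists i; rewrite // scaler_eq0 signr_eq0.
split=> pos f fnz; first by rewrite EK -E; apply: pos; apply: nz.
by rewrite E; apply: pos; apply: nz.
Qed.

End BlockForms.

(** * From the stated definitions to the linearization *)

Lemma ctrE (R : realType) m n (M : 'M[R[i]]_(m, n)) : ctr M = M^t*.
Proof. by rewrite /ctr map_trmx. Qed.

Lemma hurwitzP (R : realType) p n (A a : nat -> 'M[R[i]]_p) :
  (forall k, (k <= n.+1)%N -> a k = A k) -> hurwitz n.+1 A <-> stable n a.
Proof.
move=> aA.
have detE z : root (\det (Fpoly n.+1 A)) z <->
    exists2 l : 'cV_p, l != 0 & polmx n a z *m l = 0.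
  rewrite rootE -[_.[z]]/(horner_eval z _) -det_map_mx.
  have -> : map_mx (horner_eval z) (Fpoly n.+1 A) = polmx n a z.
    apply/matrixP => i j; rewrite !mxE summxE /horner_eval horner_sum.
    by apply: eq_bigr => k _; rewrite !hornerE mxE aA 1?mulrC // -ltnS.
  (* [det0P] concerns row kernels, so the determinant is transposed to obtain a column [l]. *)
  rewrite -det_tr; split=> [/det0P [v v0 vP]|[l l0 lP]].
    by exists v^T; rewrite ?trmx_eq0 // -[polmx _ _ _]trmxK -trmx_mul vP trmx0.
  by apply/det0P; exists l^T; rewrite ?trmx_eq0 // -trmx_mul lP trmx0.
split=> [hur z l l0 lP|st z /detE [l l0]]; last exact: st.
by apply/hur/detE; exists l.
Qed.

Lemma posdef_hankel (R : realType) p d q (s : nat -> 'M[R[i]]_p) :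
  (forall j k, (j < q)%N -> (k < q)%N -> hermitian_mx (s (j + k + d)%N)) ->
  posdef_mx (hankel s d q) <->
  (forall f, (exists2 i, (i < q)%N & f i != 0) ->
    0 < bform q (fun j k => s (j + k + d)%N) f).
Proof.
move=> sh; rewrite -qform_mxblock_gt0 /posdef_mx.
have hs : hermitian_mx (hankel s d q).
  rewrite /hermitian_mx ctrE trC_mxblock; apply: eq_mxblock => i j.
  by rewrite -ctrE addnAC addnC [X in s X](_ : _ = i + j + d)%N ?sh //; lia.
split=> [[_ pos] x x0|pos].
  have := pos (x^t*); rewrite ctrE trmxCK; apply.
  by apply: contra_neq x0 => x0; rewrite -[x]trmxCK x0 trC0.
split=> // v v0; rewrite ctrE; have := pos (v^t*); rewrite /qform trmxCK; apply.
by apply: contra_neq v0 => v0; rewrite -[v]trmxCK v0 trC0.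
Qed.

(** For even [r] this is the Markov equation of order [r./2], whose cutoffs amount to an index at
    most [n] in both parities of [n]. For odd [r] both sides vanish by parity. *)
Lemma markov_paramsE (R : realType) p n (A s : nat -> 'M[R[i]]_p) :
  let a k := if (k <= n)%N then A k else 0 in
  let g k := if odd k then 0 else (-1) ^+ k./2 *: s k./2 in
  markov_params n A s ->
  forall r, oddpart a r.+1 = \sum_(j < r.+1) g (r - j)%N *m evpart a j.
Proof.
move=> a g ms r; rewrite (sum_parity (fun j => g (r - j)%N *m evpart a j)).
rewrite [X in _ + X]big1 => [|j _]; last by rewrite /evpart /= odd_double mulmx0.
rewrite addr0 /oddpart /=; case: ifPn => [r_even|].
  have rE : r = r./2.*2 by rewrite -[LHS]odd_double_half (negPf r_even).
  have -> : a r.+1 = \sum_(j < r./2.+1)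
      (-1) ^+ (r./2 - j) *: (s (r./2 - j)%N *m a j.*2).
    move: ms; rewrite /markov_params; case: ifPn => n_even => [/(_ r./2)|/(_ r./2)].
      rewrite /Fo_coef /Fe_coef n_even => E.
      transitivity (if (1 <= r./2.+1 <= n./2)%N then A r./2.+1.*2.-1 else 0).
        rewrite /a doubleS /= -rE.
        have -> : (r < n)%N = (r./2 < n./2)%N by lia.
        by [].
      rewrite E; apply: eq_bigr => j _.
      rewrite /a; have -> : (j <= n./2)%N = (j.*2 <= n)%N by lia.
      by [].
    rewrite /Fo_coef /Fe_coef (negPf n_even) => E.
    transitivity (if (r./2 <= n./2)%N then A r./2.*2.+1 else 0).
      rewrite /a -rE; have -> : (r < n)%N = (r./2 <= n./2)%N by lia.
      by [].
    rewrite E; apply: eq_bigr => j _.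
    rewrite /a; have -> : (j <= n./2)%N = (j.*2 <= n)%N by lia.
    by [].
  apply: eq_bigr => j _; rewrite /evpart odd_double /g.
  have -> : odd (r - j.*2) = false by have := ltn_ord j; lia.
  by rewrite scalemxAl; congr ((-1) ^+ _ *: s _ *m _); lia.
rewrite negbK => r_odd; apply/esym/big1 => j _; rewrite /g.
have -> : odd (r - j.*2) by have := ltn_ord j; rewrite /= ; lia.
by rewrite mul0mx.
Qed.

Local Open Scope complex_scope.

Theorem theorem4p4 (R : realType) (p n : nat) (A : nat -> 'M[R[i]]_p)
  (s : nat -> 'M[R[i]]_p) :
  A 0%N = 1%:M ->
  markov_params n A s ->
  (forall k : nat, (k < n)%N -> hermitian_mx (s k)) ->
  (hurwitz n A <-> stieltjes_posdef n s).
Proof.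
move=> A0 ms sh; rewrite /stieltjes_posdef.
rewrite !posdef_hankel; try by move=> j k jq kq; apply: sh; lia.
case: n ms sh => [|n] ms sh.
  (* In degree 0 the polynomial is the identity, without roots, and both Hankel matrices are
     empty. *)
  split=> [_|_ z]; first by split=> f [].
  have -> : Fpoly 0 A = 1%:M.
    apply/matrixP => i j; rewrite !mxE big_ord1 A0 mxE subnn expr0 mulr1.
    by case: (i == j).
  by rewrite det1 rootE hornerE oner_eq0.
pose a k := if (k <= n.+1)%N then A k else 0.
pose g k := if odd k then 0 else (-1) ^+ k./2 *: s k./2.
have a0 : a 0%N = 1%:M by [].
have a_gt k : (n.+1 < k)%N -> a k = 0 by move=> kn; rewrite /a leqNgt kn.
have g_odd k : odd k -> g k = 0 by rewrite /g => ->.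
have g_herm k : (k < n.+1.*2)%N -> (g k)^t* = g k.
  move=> kn; rewrite /g; case: ifP => _; first by rewrite trC0.
  by rewrite trC_signZ -ctrE sh //; lia.
have g_rec := markov_paramsE ms.
rewrite (@hurwitzP _ _ _ A a) => [|k kn]; last by rewrite /a kn.
have -> : stable n a <-> (forall x, x != 0 -> 0 < qform (shank n g) x).
  split; first exact: stable_posdef.
  exact: posdef_stable.
rewrite (qform_mxblock_gt0 n.+1 (fun i j => (-1) ^+ i *: g (i + j)%N)).
rewrite bform_gt0_parity => [|i j /g_odd ->]; last by rewrite scaler0.
(* Even rows: the row sign is trivial, and [g] carries [(-1) ^+ (i + j)], removed by a diagonal sign
   change. *)
rewrite (@bform_sign_gt0 _ _ _ (fun i j => s (i + j + 0)%N)) => [|i j]; last first.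
  rewrite /g -doubleD odd_double doubleK addn0 -[(-1) ^+ i.*2]signr_odd odd_double.
  by rewrite expr0 scale1r.
(* Odd rows: the row sign [-1] and the sign [(-1) ^+ (i + j).+1] of [g] combine to
   [(-1) ^+ (i + j)]. *)
rewrite (@bform_sign_gt0 _ _ n.+1./2 (fun i j => s (i + j + 1)%N)) // => i j.
rewrite /g addSn addnS -doubleD -doubleS odd_double doubleK addn1.
by rewrite -[(-1) ^+ i.*2.+1]signr_odd /= odd_double expr1 scalerA exprS mulrA mulrNN !mul1r.
Qed.
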